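(* Let $z\in\mathbb{R}^n$, and let $y^+\neq z$ be a strict global minimizer (in the global variable $y$) of the problem $$\min_{x,y}\ \sum_{i=1}^N F_i^z(x_i)\quad\text{s.t. }\ x_i=y,\quad i=1,\dots,N,$$ generated by the lower level of CALADIN-Prox or of CADMM-Prox (described in the context) with $z$ as the initial point. Then $$\Phi^{(z,z)}(z)-\Phi^{(y^+,y^+)}(y^+)>\frac{\gamma N}{2}\|y^+-z\|^2>0 ,$$ where an argument $v\in\mathbb{R}^n$ of $\Phi^{(\cdot,\cdot)}$ means $x=(v,\dots,v)$.
   Context: Let $f_i:\mathbb{R}^n\to\mathbb{R}$, $i=1,\dots,N$, be potentially non-smooth, non-convex functions bounded from below, with (sub)gradient denoted $\partial f_i$. They define the consensus problem $\min_{x,y}\sum_{i=1}^Nf_i(x_i)$ s.t. $x_i=y$ for all $i$; it is assumed that at all its local minimizers the second order sufficient condition and the linear independence constraint qualification hold. For $z\in\mathbb{R}^n$ and $\gamma>0$ sufficiently large, set $F_i^z(x_i)=f_i(x_i)+\frac{\gamma}{2}\|x_i-z\|^2$; $\gamma$ is such that each $F_i^z$ is strongly convex. The merit function, for $x=(x_1,\dots,x_N)$ with $x_i\in\mathbb{R}^n$, is $$\Phi^{(z,y)}(x)=\sum_{i=1}^N F_i^z(x_i)+\sum_{i=1}^N\sigma_i\|x_i-y\|_1,$$ where $\sigma_i$ is sufficiently large that $\sigma_i\ge\|\lambda_i\|_\infty$, with $\lambda_i\in\mathbb{R}^n$ the dual variable of agent $i$. In particular $\Phi^{(z,z)}(z)=\sum_{i=1}^Nf_i(z)$.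 Lower levels (iterated with $z$ fixed, initialized with $y=z$ and initial guesses $\lambda_i$; $\rho>0$, $\beta\ge0$, $B_i\succ0$ symmetric): CALADIN-Prox: with $\lambda_i=B_i(x_i^--y)-g_i$ (using $x_i^-$, $g_i$ from the previous iteration), (1) compute $x_i^+=y+B_i^{-1}(\gamma(z-y)-\lambda_i-\partial f_i(y))$, or alternatively repeat finitely often $x_i^-\leftarrow x_i^+$ (starting from $x_i^-=y$), $x_i^+=(B_i+\gamma I)^{-1}(\gamma z+B_iy-\lambda_i-\partial f_i(x_i^-))$; (2) set $g_i=B_i(y-x_i^+)-\lambda_i$; (3) set $y^+=\big(\sum_iB_i+\beta I\big)^{-1}\big(\beta y+\sum_i(B_ix_i^+-g_i)\big)$. CADMM-Prox: (1) update the dual to $\lambda_i+\rho(x_i-y)$, then compute $x_i^+=y+\frac1\rho(\gamma(z-y)-\lambda_i-\partial f_i(y))$, or alternatively repeat finitely often $x_i^-\leftarrow x_i^+$ (starting from $x_i^-=y$), $x_i^+=\frac{1}{\gamma+\rho}(\gamma z+\rho y-\lambda_i-\partial f_i(x_i^-))$; (2) set $y^+=\frac{1}{N\rho+\beta}\big(\beta y+\sum_i(\rho x_i^++\lambda_i)\big)$. *)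

(* Defs.v *)
(* MathComp-Analysis; R^n is 'cV[R]_n, and the tuple (x_1, ..., x_N) is the
   n x N matrix whose i-th column is x_i. *)
From HB Require Import structures.
From mathcomp Require Import all_boot all_order all_algebra.
From mathcomp Require Import all_classical all_reals all_analysis.
Set Implicit Arguments.
Unset Strict Implicit.
Unset Printing Implicit Defensive.
Import Order.TTheory GRing.Theory Num.Theory.
Import numFieldNormedType.Exports.
Local Open Scope classical_set_scope.
Local Open Scope ring_scope.

Section Euclidean.
Context {R : realType} {n : nat}.
Implicit Types (u v x y s : 'cV[R]_n) (f : 'cV[R]_n -> R).

Definition dot u v : R := \sum_k u k 0 * v k 0.

(* The library norm `|v| on 'cV[R]_n is the sup norm. *)
Definition enorm v : R := Num.sqrt (dot v v).

Definition l1norm v : R := \sum_k `|v k 0|.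

Definition posdef (B : 'M[R]_n) : Prop :=
  B^T = B /\ forall v, v != 0 -> 0 < (v^T *m B *m v) 0 0.

Definition strongly_convex f : Prop :=
  exists2 m : R, 0 < m &
    convex_function [set: convex_lmodType 'cV[R]_n]
      (fun v => f v - m / 2 * enorm v ^+ 2).

Definition bounded_from_below f : Prop := exists m : R, forall v, m <= f v.

(* Regular (Fréchet) subgradients.  They reduce to the gradient where f is
   differentiable; when f + (gamma / 2) |. - z|^2 is convex, they coincide with
   the limiting and the Clarke subgradients. *)
Definition subgradient f x : set 'cV[R]_n := [set s |
  (0 <= limf_einf
    (fun y => ((f y - f x - dot s (y - x)) / enorm (y - x))%:E) x^')%E].

End Euclidean.

(* Second subderivative (Rockafellar-Wets) of L at w for the subgradient 0, in
   direction d; for L of class C^2 with zero gradient at w, this is the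
   quadratic form of the Hessian of L at w. *)
Definition second_subderivative {R : realType} {W : normedModType R}
    (L : W -> R) (w d : W) : \bar R :=
  limf_einf (fun p : R * W =>
    ((L (w + p.1 *: p.2) - L w) / (p.1 ^+ 2 / 2))%:E)
    (filter_prod 0^'+ (nbhs d)).

Section Consensus.
Context {R : realType} {n N : nat}.
Local Notation V := 'cV[R]_n.
Local Notation X := 'M[R]_(n, N).
Local Notation W := (X * V)%type.
Implicit Types (f : 'I_N -> V -> R) (w : W) (lam : X).

Definition objective f (x : X) : R := \sum_i f i (col i x).

Definition constraint (i : 'I_N) w : V := col i w.1 - w.2.

Definition feasible w : Prop := forall i, constraint i w = 0.

Definition local_minimizer f w : Prop :=
  feasible w /\
  \forall w' \near w, feasible w' -> objective f w.1 <= objective f w'.1.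

(* Strictness and globality are with respect to the variable y. *)
Definition strict_global_minimizer f (y : V) : Prop :=
  exists x : X, feasible (x, y) /\
    forall x' y', feasible (x', y') -> y' != y ->
      objective f x < objective f x'.

Definition LICQ w : Prop :=
  forall mu : X,
    (forall d, \sum_i dot (col i mu) ('d (constraint i) w d) = 0) -> mu = 0.

Definition lagrangian f lam w : R :=
  objective f w.1 + \sum_i dot (col i lam) (constraint i w).

Definition KKT f w lam : Prop :=
  [/\ feasible w,
      forall i, subgradient (f i) (col i w.1) (- col i lam) &
      \sum_i col i lam = 0].

Definition SOSC f w : Prop :=
  exists2 lam, KKT f w lam &
    forall d : W, d != 0 -> (forall i, 'd (constraint i) w d = 0) ->
      (0 < second_subderivative (lagrangian f lam) w d)%E.

Definition prox_fun f (gamma : R) (z : V) : 'I_N -> V -> R :=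
  fun i v => f i v + gamma / 2 * enorm (v - z) ^+ 2.

Definition merit f (gamma : R) (sigma : 'I_N -> R) (z y : V) (x : X) : R :=
  \sum_i prox_fun f gamma z i (col i x)
  + \sum_i sigma i * l1norm (col i x - y).

Definition replicate (v : V) : X := \matrix_(k, i) v k 0.

End Consensus.

(* State between two iterations; ll_dual is the current dual value, before the
   update that CADMM-Prox performs at the start of its next iteration. *)
Record ll_state {R : realType} {n N : nat} := LLState {
  ll_x : 'M[R]_(n, N);
  ll_y : 'cV[R]_n;
  ll_dual : 'M[R]_(n, N) }.
Arguments ll_state : clear implicits.

Variant ll_algorithm {R : realType} {n N : nat} :=
  | CALADIN_Prox of ('I_N -> 'M[R]_n) & R (* B, beta *)
  | CADMM_Prox of R & R (* rho, beta *).
Arguments ll_algorithm : clear implicits.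

Section LowerLevel.
Context {R : realType} {n N : nat}.
Local Notation V := 'cV[R]_n.
Variables (f : 'I_N -> V -> R) (gamma : R) (z : V).
Implicit Types (S : ll_state R n N).

Definition admissible (a : ll_algorithm R n N) : Prop :=
  match a with
  | CALADIN_Prox B beta => (forall i, posdef (B i)) /\ 0 <= beta
  | CADMM_Prox rho beta => 0 < rho /\ 0 <= beta
  end.

(* Finitely many, and at least one, repetitions of u <- T(s), s in ∂g(u). *)
Inductive repeated_update (g : V -> R) (T : V -> V) : V -> V -> Prop :=
  | update_last u s : subgradient g u s -> repeated_update g T u (T s)
  | update_more u s v : subgradient g u s ->
      repeated_update g T (T s) v -> repeated_update g T u v.

Definition caladin_local (Bi : 'M[R]_n) (g : V -> R) (y lam x : V) : Prop :=
  (exists2 s, subgradient g y s &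
     x = y + invmx Bi *m (gamma *: (z - y) - lam - s)) \/
  repeated_update g
    (fun s => invmx (Bi + gamma%:M) *m (gamma *: z + Bi *m y - lam - s)) y x.

(* The dual of the new state is B_i (x_i^+ - y^+) - g_i, which is the value
   from which the next iteration starts. *)
Definition caladin_step (B : 'I_N -> 'M[R]_n) (beta : R) S S' : Prop :=
  let y := ll_y S in
  let g i := B i *m (y - col i (ll_x S')) - col i (ll_dual S) in
  [/\ forall i,
        caladin_local (B i) (f i) y (col i (ll_dual S)) (col i (ll_x S')),
      ll_y S' = invmx (\sum_i B i + beta%:M) *m
        (beta *: y + \sum_i (B i *m col i (ll_x S') - g i)) &
      forall i,
        col i (ll_dual S') = B i *m (col i (ll_x S') - ll_y S') - g i].

Definition cadmm_local (rho : R) (g : V -> R) (y lam x : V) : Prop :=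
  (exists2 s, subgradient g y s &
     x = y + rho^-1 *: (gamma *: (z - y) - lam - s)) \/
  repeated_update g
    (fun s => (gamma + rho)^-1 *: (gamma *: z + rho *: y - lam - s)) y x.

Definition cadmm_step (rho beta : R) S S' : Prop :=
  let y := ll_y S in
  [/\ forall i, col i (ll_dual S') =
        col i (ll_dual S) + rho *: (col i (ll_x S) - y),
      forall i,
        cadmm_local rho (f i) y (col i (ll_dual S')) (col i (ll_x S')) &
      ll_y S' = (N%:R * rho + beta)^-1 *:
        (beta *: y + \sum_i (rho *: col i (ll_x S') + col i (ll_dual S')))].

Definition ll_step (a : ll_algorithm R n N) : ll_state R n N -> _ -> Prop :=
  match a with
  | CALADIN_Prox B beta => caladin_step B beta
  | CADMM_Prox rho beta => cadmm_step rho beta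
  end.

(* A run of K iterations (Some K), or of infinitely many (None), from y = z. *)
Definition ll_run (a : ll_algorithm R n N) (K : option nat)
    (S : nat -> ll_state R n N) : Prop :=
  ll_y (S 0%N) = z /\
  forall k, (if K is Some m then (k < m)%N else true) ->
    ll_step a (S k) (S k.+1).

(* The last iterate of a finite run, the limit of an infinite one. *)
Definition ll_output (K : option nat) (S : nat -> ll_state R n N) (y : V) :
    Prop :=
  match K with
  | Some m => (0 < m)%N /\ ll_y (S m) = y
  | None => ll_y (S k) @[k --> \oo] --> y
  end.

Definition dominates_duals (sigma : 'I_N -> R) (K : option nat)
    (S : nat -> ll_state R n N) : Prop :=
  forall k i, (if K is Some m then (k <= m)%N else true) ->
    `|col i (ll_dual (S k))| <= sigma i.

End LowerLevel.

(* Main.v *)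
Require Import Defs.
From HB Require Import structures.
From mathcomp Require Import all_boot all_order all_algebra.
From mathcomp Require Import all_classical all_reals all_analysis.
Import Order.TTheory GRing.Theory Num.Theory.
Import numFieldNormedType.Exports.
Local Open Scope classical_set_scope.
Local Open Scope ring_scope.

(** At a consensus point [replicate v] whose copies agree with both the
    proximal centre and the global variable, the proximal and the penalty terms
    of the merit function vanish, so the merit function equals the plain
    objective (lemma [merit_replicate]).  With the centre kept at [z], the same
    point costs [N] proximal terms more (lemma [objective_prox_replicate]).
    The point [replicate z] competes with the minimizer [yp] for the proximal
    objective centred at [z], where it pays no proximal term; hence the strict
    inequality between the two proximal objectives is already the claimed
    decrease, the quadratic being what [yp] pays for its distance to [z].  The
    lower bound is positive because [yp] differs from [z] and because there is
    at least one agent: with [N = 0] the objective is constantly [0], so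
    that [yp] could not be strictly better than [z]. *)

Section Replicate.
Set Implicit Arguments.
Unset Strict Implicit.
Context {R : realType} {n N : nat}.
Implicit Types (u v z : 'cV[R]_n) (x : 'M[R]_(n, N))
  (f : 'I_N -> 'cV[R]_n -> R).

Lemma dot_ge0 v : 0 <= dot v v.
Proof. by apply: sumr_ge0 => k _; rewrite -expr2 sqr_ge0. Qed.

Lemma enorm0 : enorm (0 : 'cV[R]_n) = 0.
Proof. by rewrite /enorm /dot big1 ?sqrtr0// => k _; rewrite mxE mul0r. Qed.

Lemma l1norm0 : l1norm (0 : 'cV[R]_n) = 0.
Proof. by rewrite /l1norm big1// => k _; rewrite mxE normr0. Qed.

Lemma enorm_gt0 v : v != 0 -> 0 < enorm v.
Proof.
move=> v_neq0; rewrite sqrtr_gt0 lt_neqAle dot_ge0 andbT eq_sym.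
apply: contra v_neq0 => /eqP dot0; apply/eqP/colP => k.
rewrite mxE; apply/eqP; rewrite -sqrf_eq0 expr2.
by rewrite (psumr_eq0P _ dot0)// => j _; rewrite -expr2 sqr_ge0.
Qed.

Lemma col_replicate v (i : 'I_N) : col i (replicate v) = v.
Proof. by apply/matrixP => k j; rewrite !mxE ord1. Qed.

Lemma feasible_replicate v : feasible (replicate v : 'M[R]_(n, N), v).
Proof. by move=> i; rewrite /constraint col_replicate subrr. Qed.

Lemma feasible_eq_replicate x v : feasible (x, v) -> x = replicate v.
Proof.
move=> feas; apply/matrixP => k i.
by move/eqP: (feas i); rewrite /constraint subr_eq0 => /eqP/colP/(_ k) /[!mxE].
Qed.

(** The constraints determine the local variables from the global one, so the
    witness [x] of minimality and every competitor are replicated vectors. *)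
Lemma strict_global_minimizer_lt f u v : strict_global_minimizer f u ->
  v != u -> objective f (replicate u) < objective f (replicate v).
Proof.
move=> [x [/feasible_eq_replicate -> min_u]] vu.
exact: min_u (feasible_replicate v) vu.
Qed.

Lemma objective_prox_replicate f gamma z v :
  objective (prox_fun f gamma z) (replicate v) =
  objective f (replicate v) + gamma * N%:R / 2 * enorm (v - z) ^+ 2.
Proof.
rewrite /objective /prox_fun big_split /=; congr (_ + _).
under eq_bigr do rewrite col_replicate.
by rewrite sumr_const card_ord -[LHS]mulr_natr mulrAC (mulrAC gamma).
Qed.

Lemma objective_prox_center f gamma z :
  objective (prox_fun f gamma z) (replicate z) = objective f (replicate z).
Proof.
by rewrite objective_prox_replicate subrr enorm0 expr0n mulr0 addr0.
Qed.

Lemma merit_replicate f gamma sigma v :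
  merit f gamma sigma v v (replicate v) = objective f (replicate v).
Proof.
rewrite -[RHS](objective_prox_center f gamma) /merit [X in _ + X]big1 ?addr0//.
by move=> i _; rewrite col_replicate subrr l1norm0 mulr0.
Qed.

End Replicate.

Theorem theorem4 (R : realType) (n N : nat) (f : 'I_N -> 'cV[R]_n -> R)
    (f_bounded : forall i, bounded_from_below (f i))
    (f_regular : forall w, local_minimizer f w -> SOSC f w /\ LICQ w)
    (gamma : R) (gamma_gt0 : 0 < gamma) (z : 'cV[R]_n)
    (F_strongly_convex : forall i, strongly_convex (prox_fun f gamma z i))
    (a : ll_algorithm R n N) (a_admissible : admissible a)
    (K : option nat) (S : nat -> ll_state R n N)
    (S_run : ll_run f gamma z a K S)
    (sigma : 'I_N -> R) (sigma_large : dominates_duals sigma K S)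
    (yp : 'cV[R]_n) (yp_generated : ll_output K S yp)
    (yp_neq_z : yp != z)
    (yp_minimizer : strict_global_minimizer (prox_fun f gamma z) yp) :
  merit f gamma sigma z z (replicate z)
    - merit f gamma sigma yp yp (replicate yp)
    > gamma * N%:R / 2 * enorm (yp - z) ^+ 2
  /\ gamma * N%:R / 2 * enorm (yp - z) ^+ 2 > 0.
Proof.
have := strict_global_minimizer_lt yp_minimizer.
move=> /(_ z); rewrite eq_sym => /(_ yp_neq_z) lt_prox.
split.
  move: lt_prox; rewrite objective_prox_replicate objective_prox_center.
  by rewrite !merit_replicate ltrBrDl.
have N_gt0 : (0 < N)%N.
  (* An objective without agents takes the same value, 0, at yp and at z. *)
  rewrite lt0n; apply/eqP => N0; subst N.
  by move: lt_prox; rewrite /objective !big_ord0 ltxx.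
by rewrite !mulr_gt0 ?exprn_gt0 ?enorm_gt0 ?subr_eq0 ?ltr0n ?invr_gt0.
Qed.
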